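(* There is a (polynomial-time) $3$-approximation algorithm for the problem $$\min \sum_{i\in[k]} f(S_i)\quad\text{s.t. } S_1\uplus\cdots\uplus S_k\in\mathcal{F}\ \text{ and }\ S_i\neq\emptyset\ \text{ for all } i\in[k],$$ where $f$ is a non-negative monotone submodular function and $\mathcal{F}$ is the family of vertex covers of a graph.
   Context: The input is a finite graph $G$ with vertex set $V$, an integer $1\le k\le |V|$, and a function $f:2^V\to\mathbb{R}_+$ accessed through a value oracle (a query specifies $S\subseteq V$ and returns $f(S)$). $f$ is submodular if $f(A\cup\{v\})-f(A)\ge f(B\cup\{v\})-f(B)$ for all $A\subseteq B\subseteq V$, $v\notin B$, and monotone if $f(A)\le f(B)$ whenever $A\subseteq B\subseteq V$. A set $S\subseteq V$ is a vertex cover of $G$ if every edge of $G$ is incident on a vertex in $S$; $\mathcal{F}$ is the collection of all vertex covers of $G$. The symbol $\uplus$ denotes union of pairwise disjoint sets and $[k]=\{1,\dots,k\}$. An $\alpha$-approximation algorithm is an algorithm running in time polynomial in the input size (with oracle calls) that outputs a feasible solution of value at most $\alpha$ times the optimal value. *)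

(* Defs.v *)
From HB Require Import structures.
From mathcomp Require Import all_boot all_order all_algebra.
From mathcomp Require Import reals.

Set Implicit Arguments.
Unset Strict Implicit.
Unset Printing Implicit Defensive.

Import Order.TTheory GRing.Theory Num.Theory.

Local Open Scope ring_scope.

(* Model of computation: a real RAM with a value oracle, programmed in a
   WHILE language.  A program is a closed piece of syntax, hence independent of
   the instance.  The memory consists of natural-number arrays and of real
   arrays, both two-dimensional; arrays are named by the first natural number
   of NGet, RGet, SetN and SetR, and a scalar is the cell (0, 0) of an array.

   Natural numbers may only be added and subtracted (with truncation): with no
   multiplication, a run of t steps only produces naturals of O(t) bits, so
   that unit cost is legitimate.  Reals carry the four field operations and
   comparison, with exact values; there is no rounding and no conversion of a
   real into a natural number. *)

Inductive nexp : Type :=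
  | NLit of nat
  | NGet of nat & nexp & nexp
  | NAdd of nexp & nexp
  | NSub of nexp & nexp.

Inductive rexp : Type :=
  | RLit of nat
  | RGet of nat & nexp & nexp
  | RAdd of rexp & rexp
  | RSub of rexp & rexp
  | RMul of rexp & rexp
  | RDiv of rexp & rexp.

Inductive bexp : Type :=
  | BLeN of nexp & nexp
  | BLeR of rexp & rexp
  | BNot of bexp
  | BAnd of bexp & bexp.

(* [SetN a i j x] is a[i, j] := x, and likewise for [SetR].
   [Query r i j a l] is r[i, j] := f(S), where S is the set whose
   characteristic vector is the row l of the natural-number array a. *)
Inductive cmd : Type :=
  | Skip
  | SetN of nat & nexp & nexp & nexp
  | SetR of nat & nexp & nexp & rexp
  | Query of nat & nexp & nexp & nat & nexp
  | Seq of cmd & cmd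
  | If of bexp & cmd & cmd
  | While of bexp & cmd.

Record state (R : Type) := State {
  nmem : nat -> nat -> nat -> nat;
  rmem : nat -> nat -> nat -> R }.

Definition upd (T : Type) (m : nat -> nat -> nat -> T) (a i j : nat) (x : T) :
    nat -> nat -> nat -> T :=
  fun a' i' j' => if [&& a' == a, i' == i & j' == j] then x else m a' i' j'.

Definition setn (R : Type) (s : state R) (a i j x : nat) : state R :=
  State (upd (nmem s) a i j x) (rmem s).

Definition setr (R : Type) (s : state R) (a i j : nat) (x : R) : state R :=
  State (nmem s) (upd (rmem s) a i j x).

(* The subset of {0, ..., n-1} whose characteristic vector is row i of a. *)
Definition rowset (R : Type) (n : nat) (s : state R) (a i : nat) : {set 'I_n} :=
  [set v : 'I_n | nmem s a i v != 0%N].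

Fixpoint neval (R : Type) (s : state R) (x : nexp) : nat :=
  match x with
  | NLit c => c
  | NGet a i j => nmem s a (neval s i) (neval s j)
  | NAdd x1 x2 => (neval s x1 + neval s x2)%N
  | NSub x1 x2 => (neval s x1 - neval s x2)%N
  end.

(* Division by 0 returns 0, as in the library. *)
Fixpoint reval (R : realType) (s : state R) (x : rexp) : R :=
  match x with
  | RLit c => c%:R
  | RGet a i j => rmem s a (neval s i) (neval s j)
  | RAdd x1 x2 => reval s x1 + reval s x2
  | RSub x1 x2 => reval s x1 - reval s x2
  | RMul x1 x2 => reval s x1 * reval s x2
  | RDiv x1 x2 => reval s x1 / reval s x2
  end.

Fixpoint beval (R : realType) (s : state R) (b : bexp) : bool :=
  match b with
  | BLeN x1 x2 => (neval s x1 <= neval s x2)%N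
  | BLeR x1 x2 => reval s x1 <= reval s x2
  | BNot b1 => ~~ beval s b1
  | BAnd b1 b2 => beval s b1 && beval s b2
  end.

(* [exec f P s s' t]: with oracle f, the program P started in s halts in s'
   after t steps.  Every assignment, test and oracle call counts for one step;
   the expressions of a program have a size that does not depend on the input,
   so that counting their operations would only change t by a constant
   factor. *)
Inductive exec (R : realType) (n : nat) (f : {set 'I_n} -> R) :
    cmd -> state R -> state R -> nat -> Prop :=
  | exec_Skip s : exec f Skip s s 1
  | exec_SetN a i j x s :
      exec f (SetN a i j x) s
           (setn s a (neval s i) (neval s j) (neval s x)) 1
  | exec_SetR a i j x s :
      exec f (SetR a i j x) s
           (setr s a (neval s i) (neval s j) (reval s x)) 1
  | exec_Query r i j a l s :
      exec f (Query r i j a l) s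
           (setr s r (neval s i) (neval s j) (f (rowset n s a (neval s l)))) 1
  | exec_Seq c1 c2 s1 s2 s3 t1 t2 :
      exec f c1 s1 s2 t1 -> exec f c2 s2 s3 t2 ->
      exec f (Seq c1 c2) s1 s3 (t1 + t2)
  | exec_IfTrue b c1 c2 s s' t :
      beval s b -> exec f c1 s s' t -> exec f (If b c1 c2) s s' t.+1
  | exec_IfFalse b c1 c2 s s' t :
      ~~ beval s b -> exec f c2 s s' t -> exec f (If b c1 c2) s s' t.+1
  | exec_WhileFalse b c s :
      ~~ beval s b -> exec f (While b c) s s 1
  | exec_WhileTrue b c s1 s2 s3 t1 t2 :
      beval s1 b -> exec f c s1 s2 t1 -> exec f (While b c) s2 s3 t2 ->
      exec f (While b c) s1 s3 (t1 + t2).+1.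

(* The vertex set is {0, ..., n-1}.  Initially the natural-number arrays 0 and
   1 hold n and k in their cell (0, 0), array 2 holds the adjacency matrix of
   the graph, and all other cells are 0; f is only available as the oracle. *)
Definition input (R : realType) (n k : nat) (e : rel 'I_n) : state R :=
  State
    (fun a i j =>
       match a with
       | 0 => if (i == 0) && (j == 0) then n else 0
       | 1 => if (i == 0) && (j == 0) then k else 0
       | 2 => [exists u : 'I_n, exists v : 'I_n,
                 [&& val u == i, val v == j & e u v]]
       | _ => 0
       end%N)
    (fun _ _ _ => 0).

(* The rows 0, ..., k-1 of array 3 are read as S_1, ..., S_k. *)
Definition output (R : realType) (n k : nat) (s : state R) :
    'I_k -> {set 'I_n} :=
  fun i => rowset n s 3 i.

Arguments input R {n} k e.
Arguments output {R} n k s.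

Section Problem.

Variables (R : realType) (n : nat).
Implicit Types (f : {set 'I_n} -> R) (e : rel 'I_n).

Definition nonnegative f : Prop := forall A : {set 'I_n}, 0 <= f A.

Definition monotone f : Prop :=
  forall A B : {set 'I_n}, A \subset B -> f A <= f B.

Definition submodular f : Prop :=
  forall (A B : {set 'I_n}) (v : 'I_n), A \subset B -> v \notin B ->
    f (B :|: [set v]) - f B <= f (A :|: [set v]) - f A.

Definition vertex_covers e : {set {set 'I_n}} :=
  [set S : {set 'I_n} |
    [forall u, forall v, e u v ==> (u \in S) || (v \in S)]].

Variable k : nat.
Implicit Types S T : 'I_k -> {set 'I_n}.

Definition feasible e S : Prop :=
  [/\ forall i j : 'I_k, i != j -> [disjoint S i & S j],
      \bigcup_i S i \in vertex_covers e
    & forall i : 'I_k, S i != set0].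

Definition cost f S : R := \sum_i f (S i).

Definition optimal e f T : Prop :=
  feasible e T /\ forall S, feasible e S -> cost f T <= cost f S.

End Problem.

(* Main.v *)
Require Import Defs.
From HB Require Import structures.
From mathcomp Require Import all_boot all_order all_algebra.
From mathcomp Require Import reals.
From mathcomp Require Import boolp zify ring lra.

Set Implicit Arguments.
Unset Strict Implicit.
Unset Printing Implicit Defensive.

Import Order.TTheory GRing.Theory Num.Theory.

Local Open Scope ring_scope.

(* Let O range over vertex covers.  A 2-approximation C of min f(O) comes from
   a distribution on vertex sets, A_l having weight W_l, with expectation E.
   It starts at the empty set.  While an edge has no endpoint that belongs to
   all the A_l, let g_p <= g_q be the increases of E[f] caused by adding p,
   resp. q, to every A_l; then q is added to a part of the distribution that
   makes E[f] grow by exactly g_p, and p is added everywhere.  By submodularity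
   E[f] grows by at most 2 g_p, while E[f(. U O)] - E[f] drops by at least g_p
   because O contains p or q.  At the end the set C of the vertices that belong
   to all the A_l is a cover and f(C) <= E[f] <= 2 f(O).  The part of the
   distribution receiving q is chosen greedily, which splits at most one A_l;
   the support thus has at most n + 1 sets.

   For the partition, order the vertices by f({v}), give one each of the first
   k to S_1, ..., S_k, and add the rest of C to S_k.  The first contribution is
   at most the optimum, since the optimal parts have distinct representatives;
   the second is at most 2 f(T_1 U ... U T_k) <= 2 (f(T_1) + ... + f(T_k)). *)

(** * Submodular functions and ranks *)

Section SubmodularFunctions.

Variables (R : realType) (n : nat) (f : {set 'I_n} -> R).
Hypotheses (f_ge0 : nonnegative f) (f_mono : monotone f).
Hypothesis (f_sub : submodular f).

(** The elements of X are added one at a time. Monotonicity handles an element already in B: the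
    increase over B is then 0, and the one over A is nonnegative. *)
Lemma submodular_marginal (A B X : {set 'I_n}) :
  A \subset B -> f (B :|: X) - f B <= f (A :|: X) - f A.
Proof.
move=> sAB; have [m] := ubnP #|X|; elim: m X => // m IH X.
have [->|[x xX]] := set_0Vmem X; first by rewrite !setU0 !subrr.
rewrite (cardsD1 x) xX ltnS => /IH {IH}.
have UX C : C :|: X = (C :|: X :\ x) :|: [set x].
  by rewrite -setUA (setUC (X :\ x)) setD1K.
rewrite !UX; set A' := A :|: X :\ x; set B' := B :|: X :\ x => leAB.
have sAB' : A' \subset B' by rewrite setSU.
suff : f (B' :|: [set x]) - f B' <= f (A' :|: [set x]) - f A' by lra.
have [xB'|] := boolP (x \in B'); last exact: f_sub.
have /setUidPl -> : [set x] \subset B' by rewrite sub1set.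
by rewrite subrr subr_ge0 f_mono ?subsetUl.
Qed.

Lemma subadditive (A B : {set 'I_n}) : f (A :|: B) <= f A + f B.
Proof.
have := submodular_marginal B (sub0set A); rewrite set0U.
have := f_ge0 set0; lra.
Qed.

Lemma bigcup_le_sum (I : finType) (S : I -> {set 'I_n}) :
  (0 < #|I|)%N -> f (\bigcup_i S i) <= \sum_i f (S i).
Proof.
move=> I_gt0.
(* The normalised function f - f(0) vanishes on the empty union, which starts the induction;
   restoring f(0) takes at least one index. *)
suff le_sum : f (\bigcup_i S i) - f set0 <= \sum_i (f (S i) - f set0).
  have : f set0 <= \sum_(i : I) f set0.
    by rewrite sumr_const -mulr_natr ler_peMr // ler1n.
  by move: le_sum; rewrite sumrB; lra.
apply: (big_ind2 (fun X y => f X - f set0 <= y)) => [|A a B b leA leB|//].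
  by rewrite subrr.
by have := submodular_marginal B (sub0set A); rewrite set0U; lra.
Qed.

End SubmodularFunctions.

(** * Ranking the vertices by a real value *)

Section Rank.

Variables (R : realType) (n : nat) (g : 'I_n -> R).

(** Ties are broken by the index, which makes the order strict and total, so that ranks run
    bijectively over 0, ..., n-1. *)
Definition precedes (w v : 'I_n) : bool :=
  (g w < g v) || (g w <= g v) && (w < v)%N.

Definition rank (v : 'I_n) : nat := #|[set w | precedes w v]|.

Lemma precedes_irr v : precedes v v = false.
Proof. by rewrite /precedes ltxx ltnn andbF. Qed.

Lemma precedes_trans : transitive precedes.
Proof.
move=> v u w; rewrite /precedes => /orP[h1|/andP[h1 k1]] /orP[h2|/andP[h2 k2]].
- by rewrite (lt_trans h1 h2).
- by rewrite (lt_le_trans h1 h2).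
- by rewrite (le_lt_trans h1 h2).
- by rewrite (le_trans h1 h2) (ltn_trans k1 k2) orbT.
Qed.

Lemma precedes_total u v : u != v -> precedes u v || precedes v u.
Proof.
rewrite /precedes; case: (ltgtP (g u) (g v)) => //= _.
by rewrite -val_eqE /=; case: ltngtP.
Qed.

Lemma rank_lt u v : precedes u v -> (rank u < rank v)%N.
Proof.
move=> uv; apply/proper_card/properP; split.
  by apply/subsetP => w; rewrite !inE => /precedes_trans; apply.
by exists u; rewrite inE ?precedes_irr.
Qed.

Lemma rank_inj : injective rank.
Proof.
move=> u v ruv; apply/eqP; apply: contraT => /precedes_total.
by case/orP => /rank_lt; rewrite ruv ltnn.
Qed.

Lemma rank_ltn v : (rank v < n)%N.
Proof.
rewrite -[X in (_ < X)%N]card_ord -cardsT; apply/proper_card/properP.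
by split; [exact: subsetT | exists v; rewrite inE ?precedes_irr].
Qed.

Lemma rank_surj i : (i < n)%N -> exists v, rank v = i.
Proof.
move=> lt_in; pose r v := Ordinal (rank_ltn v).
have r_inj : injective r by move=> u v [] /rank_inj.
exists (invF r_inj (Ordinal lt_in)).
by have /(congr1 val) := f_invF r_inj (Ordinal lt_in).
Qed.

Lemma rank_le u v : (rank u <= rank v)%N -> g u <= g v.
Proof.
move=> ruv; have [-> //|/precedes_total/orP[|/rank_lt]] := eqVneq u v.
  by case/orP => [/ltW|/andP[]].
by rewrite ltnNge ruv.
Qed.

(** Exchange argument: L and U have k elements each, so L minus U and U minus L have equal size, and
    the value at the vertex of rank k-1 separates them. *)
Lemma sum_rank_le (k : nat) (U : {set 'I_n}) :
  (k <= n)%N -> #|U| = k ->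
  \sum_(v | (rank v < k)%N) g v <= \sum_(v in U) g v.
Proof.
move=> le_kn cardU; pose L := [set v | (rank v < k)%N].
have cardL : #|L| = k.
  rewrite -[RHS]card_ord.
  have /fin_all_exists[r rP] : forall i : 'I_k, exists v, rank v = i.
    by move=> i; apply: rank_surj; apply: leq_trans le_kn.
  have r_inj : injective r.
    by move=> i j eij; apply/val_inj; rewrite /= -!rP eij.
  rewrite -(card_imset _ r_inj); apply: eq_card => v; rewrite inE.
  apply/idP/imsetP => [rv|[i _ ->]]; last by rewrite rP ltn_ord.
  by exists (Ordinal rv) => //; apply: rank_inj; rewrite rP.
have -> : \sum_(v | (rank v < k)%N) g v = \sum_(v in L) g v.
  by apply: eq_bigl => v; rewrite inE.
rewrite (big_setID U) [leRHS](big_setID L) /= [U :&: L]setIC.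
have cardD : #|L :\: U| = #|U :\: L|.
  apply/eqP; rewrite -(eqn_add2l #|L :&: U|) cardsID.
  by rewrite [L :&: U]setIC cardsID cardL cardU.
rewrite lerD2l; case: (posnP k) => [k0|k_gt0].
  have /eqP := cardL; have /eqP := cardU.
  by rewrite k0 !cards_eq0 => /eqP -> /eqP ->; rewrite !setD0.
have [z rz] : exists z, rank z = k.-1 by apply: rank_surj; lia.
apply: (@le_trans _ _ (\sum_(v in L :\: U) g z)).
  by apply: ler_sum => v; rewrite !inE => /andP[_ rv]; apply: rank_le; lia.
rewrite sumr_const cardD -sumr_const; apply: ler_sum => v.
by rewrite !inE => /andP[rv _]; apply: rank_le; lia.
Qed.

End Rank.

(** * A FOR language compiled to the WHILE language *)

(* [PFor a c p] runs p with the cell a[0, 0] going through 0, ..., n+c-1, where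
   n is the content of 0[0, 0]. *)
Inductive prog : Type :=
  | PSkip
  | PSetN of nat & nexp & nexp & nexp
  | PSetR of nat & nexp & nexp & rexp
  | PQuery of nat & nexp & nexp & nat & nexp
  | PSeq of prog & prog
  | PIf of bexp & prog & prog
  | PFor of nat & nat & prog.

Definition nvar (a : nat) : nexp := NGet a (NLit 0) (NLit 0).
Definition rvar (a : nat) : rexp := RGet a (NLit 0) (NLit 0).

Fixpoint compile (p : prog) : cmd :=
  match p with
  | PSkip => Skip
  | PSetN a i j x => SetN a i j x
  | PSetR a i j x => SetR a i j x
  | PQuery r i j a l => Query r i j a l
  | PSeq p1 p2 => Seq (compile p1) (compile p2)
  | PIf b p1 p2 => If b (compile p1) (compile p2)
  | PFor a c p1 =>
      Seq (SetN a (NLit 0) (NLit 0) (NLit 0))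
        (While (BLeN (NAdd (nvar a) (NLit 1)) (NAdd (nvar 0) (NLit c)))
           (Seq (compile p1)
              (SetN a (NLit 0) (NLit 0) (NAdd (nvar a) (NLit 1)))))
  end.

Fixpoint nfree (a : nat) (p : prog) : bool :=
  match p with
  | PSetN b _ _ _ => b != a
  | PSeq p1 p2 | PIf _ p1 p2 => nfree a p1 && nfree a p2
  | PFor b _ p1 => (b != a) && nfree a p1
  | _ => true
  end.

Fixpoint rfree (a : nat) (p : prog) : bool :=
  match p with
  | PSetR b _ _ _ | PQuery b _ _ _ _ => b != a
  | PSeq p1 p2 | PIf _ p1 p2 => rfree a p1 && rfree a p2
  | PFor _ _ p1 => rfree a p1
  | _ => true
  end.

(** A loop body may change neither its counter nor the bound n, so the number of rounds is known on
    entry. *)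
Fixpoint wf (p : prog) : bool :=
  match p with
  | PSeq p1 p2 | PIf _ p1 p2 => wf p1 && wf p2
  | PFor a _ p1 => [&& wf p1, a != 0%N, nfree a p1 & nfree 0 p1]
  | _ => true
  end.

(** A static upper bound. A round costs its body, a test and an increment; the last 2 of a loop is
    the initialisation and the failing test. A conditional is charged for both branches. *)
Fixpoint time (n : nat) (p : prog) : nat :=
  match p with
  | PSeq p1 p2 => time n p1 + time n p2
  | PIf _ p1 p2 => (time n p1 + time n p2).+1
  | PFor _ c p1 => (n + c) * (time n p1 + 2) + 2
  | _ => 1
  end.

Lemma time_poly (p : prog) :
  exists C d, forall n, (0 < n)%N -> (time n p <= C * n ^ d)%N.
Proof.
have one : exists C d, forall n, (0 < n)%N -> (1 <= C * n ^ d)%N.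
  by exists 1%N, 0%N.
elim: p => //=.
- move=> p1 [C1 [d1 H1]] p2 [C2 [d2 H2]]; exists (C1 + C2)%N, (d1 + d2)%N.
  move=> n n0; have := H1 n n0; have := H2 n n0; rewrite expnD.
  have : (0 < n ^ d1)%N by rewrite expn_gt0 n0.
  have : (0 < n ^ d2)%N by rewrite expn_gt0 n0.
  nia.
- move=> _ p1 [C1 [d1 H1]] p2 [C2 [d2 H2]]; exists (C1 + C2).+1, (d1 + d2)%N.
  move=> n n0; have := H1 n n0; have := H2 n n0; rewrite expnD.
  have : (0 < n ^ d1)%N by rewrite expn_gt0 n0.
  have : (0 < n ^ d2)%N by rewrite expn_gt0 n0.
  nia.
- move=> _ c p [C [d H]]; exists (c.+1 * (C + 2) + 2)%N, d.+1 => n n0.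
  have := H n n0; rewrite expnS; have : (0 < n ^ d)%N by rewrite expn_gt0 n0.
  move: (time n p) (n ^ d)%N => t m m0 tm.
  (* For positive n, the number n + c of rounds is at most (c + 1) n, so each loop raises the degree
     by one. *)
  apply: (@leq_trans ((c.+1 * n) * ((C + 2) * m) + 2 * (n * m))).
    apply: leq_add; last by nia.
    by apply: leq_mul; nia.
  by nia.
Qed.

(** * Functional semantics, frame properties and loop rule *)

Section Semantics.

Variables (R : realType) (n : nat) (f : {set 'I_n} -> R).
Implicit Types (s : state R) (p : prog).

(** FOR programs always halt, so their effect is a function defined by recursion on the syntax. *)
Fixpoint run p s : state R :=
  match p with
  | PSkip => s
  | PSetN a i j x => setn s a (neval s i) (neval s j) (neval s x)
  | PSetR a i j x => setr s a (neval s i) (neval s j) (reval s x)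
  | PQuery r i j a l =>
      setr s r (neval s i) (neval s j) (f (rowset n s a (neval s l)))
  | PSeq p1 p2 => run p2 (run p1 s)
  | PIf b p1 p2 => if beval s b then run p1 s else run p2 s
  | PFor a c p1 =>
      iter (nmem s 0 0 0 + c)
        (fun s' => let s1 := run p1 s' in setn s1 a 0 0 (nmem s1 a 0 0 + 1)%N)
        (setn s a 0 0 0)
  end.

Lemma run_PSeq p1 p2 s : run (PSeq p1 p2) s = run p2 (run p1 s).
Proof. by []. Qed.

Lemma run_PIf b p1 p2 s :
  run (PIf b p1 p2) s = if beval s b then run p1 s else run p2 s.
Proof. by []. Qed.

Lemma nmem_run p s a i j :
  nfree a p -> nmem (run p s) a i j = nmem s a i j.
Proof.
have upd_neq (m : nat -> nat -> nat -> nat) b i' j' x :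
    b != a -> upd m b i' j' x a i j = m a i j.
  by rewrite /upd eq_sym => /negbTE ->.
elim: p s => //= [b i' j' x|p1 IH1 p2 IH2|b p1 IH1 p2 IH2|b c p IH] s.
- exact: upd_neq.
- by case/andP => h1 h2; rewrite IH2 // IH1.
- by case/andP => h1 h2; case: ifP => _; [exact: IH1 | exact: IH2].
- case/andP => ba pa; rewrite -[RHS](upd_neq _ b 0%N 0%N 0%N ba).
  by elim: (_ + c)%N => //= m <-; rewrite upd_neq // IH.
Qed.

Lemma rmem_run p s a i j :
  rfree a p -> rmem (run p s) a i j = rmem s a i j.
Proof.
have upd_neq (m : nat -> nat -> nat -> R) b i' j' x :
    b != a -> upd m b i' j' x a i j = m a i j.
  by rewrite /upd eq_sym => /negbTE ->.
elim: p s => //=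
  [b i' j' x|b i' j' x l|p1 IH1 p2 IH2|b p1 IH1 p2 IH2|b c p IH] s.
- exact: upd_neq.
- exact: upd_neq.
- by case/andP => h1 h2; rewrite IH2 // IH1.
- by case/andP => h1 h2; case: ifP => _; [exact: IH1 | exact: IH2].
- by move=> pa; elim: (_ + c)%N => //= m <-; rewrite IH.
Qed.

Lemma exec_run p s N :
  wf p -> nfree 0 p -> nmem s 0 0 0 = N ->
  exists2 t, exec f (compile p) s (run p s) t & (t <= time N p)%N.
Proof.
elim: p s => /=.
- by exists 1%N => //; constructor.
- by exists 1%N => //; constructor.
- by exists 1%N => //; constructor.
- by exists 1%N => //; constructor.
- move=> p1 IH1 p2 IH2 s /andP[w1 w2] /andP[z1 z2] sN.
  have [t1 e1 l1] := IH1 s w1 z1 sN.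
  have [|t2 e2 l2] := IH2 (run p1 s) w2 z2; first by rewrite nmem_run.
  exists (t1 + t2)%N; last exact: leq_add.
  exact: exec_Seq e1 e2.
- move=> b p1 IH1 p2 IH2 s /andP[w1 w2] /andP[z1 z2] sN.
  case: ifPn => sb.
    have [t e l] := IH1 s w1 z1 sN; exists t.+1; first exact: exec_IfTrue.
    by rewrite ltnS (leq_trans l) ?leq_addr.
  have [t e l] := IH2 s w2 z2 sN; exists t.+1; first exact: exec_IfFalse.
  by rewrite ltnS (leq_trans l) ?leq_addl.
move=> a c p IH s /and4P[wp a0 pa p0] _ sN.
set body := Seq (compile p) _; set test := BLeN _ _.
pose step s' := let s1 := run p s' in setn s1 a 0 0 (nmem s1 a 0 0 + 1)%N.
(* Here m is the number of rounds left, hence the counter value N + c - m. *)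
suff loop m s1 : (m <= N + c)%N -> nmem s1 0 0 0 = N ->
    nmem s1 a 0 0 = (N + c - m)%N ->
    exists2 t, exec f (While test body) s1 (iter m step s1) t &
      (t <= m * (time N p + 2) + 1)%N.
  have [||| t et lt] := loop (N + c)%N (setn s a 0 0 0) => //.
  - by rewrite /= /upd [0%N == a]eq_sym (negbTE a0).
  - by rewrite /= /upd !eqxx subnn.
  exists (1 + t)%N; last by lia.
  rewrite sN; apply: exec_Seq et.
  exact: (exec_SetN f a (NLit 0) (NLit 0) (NLit 0)).
elim: m s1 => [|m IHm] s1 le_m s1N s1a.
  exists 1%N => //; apply: exec_WhileFalse => /=.
  by rewrite s1N s1a; lia.
have [t et lt] := IH s1 wp p0 s1N.
have [||| t' et' lt'] := IHm (step s1); first by lia.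
- by rewrite /step /= /upd [0%N == a]eq_sym (negbTE a0) /= nmem_run.
- by rewrite /step /= /upd !eqxx /= nmem_run // s1a; lia.
exists ((t + 1) + t').+1; last by lia.
rewrite iterSr; apply: exec_WhileTrue et'; first by rewrite /= s1N s1a; lia.
exact: exec_Seq et (exec_SetN _ _ _ _ _ _).
Qed.

(** Loop rule: I i is the invariant before round i, and it is restored after the counter moves on to
    i.+1. *)
Lemma run_PFor (I : nat -> state R -> Prop) a c p s N :
  nfree a p -> nmem s 0 0 0 = N ->
  I 0%N (setn s a 0 0 0) ->
  (forall i s', (i < N + c)%N -> nmem s' a 0 0 = i -> I i s' ->
     I i.+1 (setn (run p s') a 0 0 i.+1)) ->
  I (N + c)%N (run (PFor a c p) s).
Proof.
move=> pa sN I0 IS /=; rewrite sN.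
set step := (fun s' => _).
suff loop m : (m <= N + c)%N -> I m (iter m step (setn s a 0 0 0)) /\
    nmem (iter m step (setn s a 0 0 0)) a 0 0 = m by have [] := loop (N + c)%N.
elim: m => [|m IHm] le_m; first by rewrite /= /upd !eqxx.
have [Im am] := IHm (ltnW le_m).
rewrite iterS {1 3}/step /= nmem_run // am addn1; split; first exact: IS.
by rewrite /upd !eqxx.
Qed.

End Semantics.

(** * Distributions on vertex sets *)

Section Mixtures.

Variables (R : realType) (n : nat).
Implicit Types (W : nat -> R) (A : nat -> {set 'I_n}) (h : {set 'I_n} -> R).

Definition mix W A h : R := \sum_(l < n.+1) W l * h (A l).

Lemma eq_mix W A W' A' h : (forall l, (l <= n)%N -> W' l = W l) ->
  (forall l, (l <= n)%N -> A' l = A l) -> mix W' A' h = mix W A h.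
Proof.
by move=> eW eA; apply: eq_bigr => l _; rewrite eW ?eA // -ltnS.
Qed.

Lemma mixB W A h1 h2 :
  mix W A (fun X => h1 X - h2 X) = mix W A h1 - mix W A h2.
Proof. by rewrite -sumrB; apply: eq_bigr => l _; rewrite mulrBr. Qed.

Lemma mixN W A h : mix W A (fun X => - h X) = - mix W A h.
Proof. by rewrite -sumrN; apply: eq_bigr => l _; rewrite mulrN. Qed.

Lemma le_mix W A h1 h2 : (forall l, (l <= n)%N -> 0 <= W l) ->
  (forall l, (l <= n)%N -> h1 (A l) <= h2 (A l)) -> mix W A h1 <= mix W A h2.
Proof.
move=> W0 le_h; apply: ler_sum => l _.
by apply: ler_wpM2l; rewrite ?W0 ?le_h // -ltnS.
Qed.

Lemma mix_add W A A' h l X : (l <= n)%N ->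
  (forall i, (i <= n)%N -> A' i = if i == l then A l :|: X else A i) ->
  mix W A' h = mix W A h + W l * (h (A l :|: X) - h (A l)).
Proof.
move=> le_ln eA; pose l' := Ordinal (le_ln : (l < n.+1)%N).
have mixE B : mix W B h =
    W l * h (B l) + \sum_(i < n.+1 | i != l') W i * h (B i).
  by rewrite /mix (bigD1 l').
rewrite !mixE eA // eqxx.
rewrite (eq_bigr (fun i : 'I_n.+1 => W i * h (A i))) => [|i il]; first by ring.
by rewrite eA ?(negbTE (il : (i != l :> nat))) // -ltnS.
Qed.

(** A fraction t of layer l receives X; the rest moves unchanged to layer m, whose old content has
    no mass to lose. *)
Lemma mix_split W A W' A' h l m t X :
  (l <= n)%N -> (m <= n)%N -> l != m -> W m = 0 ->
  (forall i, (i <= n)%N -> W' i =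
     if i == l then W l * t else if i == m then W l * (1 - t) else W i) ->
  (forall i, (i <= n)%N -> A' i =
     if i == l then A l :|: X else if i == m then A l else A i) ->
  mix W' A' h = mix W A h + t * (W l * (h (A l :|: X) - h (A l))).
Proof.
move=> le_ln le_mn lm Wm eW eA.
pose l' := Ordinal (le_ln : (l < n.+1)%N).
pose m' := Ordinal (le_mn : (m < n.+1)%N).
have ml : m' != l' by rewrite -val_eqE /= eq_sym.
have mixE V B : mix V B h = V l * h (B l) + (V m * h (B m) +
    \sum_(i < n.+1 | (i != l') && (i != m')) V i * h (B i)).
  by rewrite /mix (bigD1 l') //= (bigD1 m').
rewrite !mixE.
rewrite !eW // !eA // !eqxx [m == l]eq_sym (negbTE lm) Wm.
rewrite (eq_bigr (fun i : 'I_n.+1 => W i * h (A i))); first by ring.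
move=> i /andP[il im].
have {}il : (i == l :> nat) = false by apply/negbTE.
have {}im : (i == m :> nat) = false by apply/negbTE.
by rewrite eW ?eA ?il ?im // -ltnS.
Qed.

End Mixtures.

(** * The potential that bounds the cost of the cover *)

Section CoverInvariant.

Variables (R : realType) (n : nat) (f : {set 'I_n} -> R) (e : rel 'I_n).
Hypotheses (f_ge0 : nonnegative f) (f_mono : monotone f).
Hypothesis (f_sub : submodular f).
Implicit Types (W : nat -> R) (A : nat -> {set 'I_n}) (h : {set 'I_n} -> R).
Implicit Types (D : {set 'I_n}).

Definition gain W A (v : 'I_n) : R :=
  mix W A (fun X => f (X :|: [set v])) - mix W A f.

Lemma eq_gain W A W' A' v : (forall l, (l <= n)%N -> W' l = W l) ->
  (forall l, (l <= n)%N -> A' l = A l) -> gain W' A' v = gain W A v.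
Proof. by move=> eW eA; rewrite /gain !(eq_mix _ eW eA). Qed.

Lemma gain_ge0 W A v : (forall l, (l <= n)%N -> 0 <= W l) -> 0 <= gain W A v.
Proof.
by move=> W0; rewrite subr_ge0 le_mix // => l _; rewrite f_mono ?subsetUl.
Qed.

(* Layer x.+1 is reserved for the set that is split off when x is saturated. *)
Record covering W A D : Prop := Covering {
  covering_ge0 : forall l, (l <= n)%N -> 0 <= W l;
  covering_sum : mix W A (fun=> 1) = 1;
  covering_cost : forall O, O \in vertex_covers e ->
    2 * mix W A (fun X => f (X :|: O)) - mix W A f <= 2 * f O - f set0;
  covering_sub : forall x l, (l <= n)%N -> x \in D -> x \in A l;
  covering_free : forall x : 'I_n, x \notin D -> W x.+1 = 0 }.

Lemma eq_covering W A W' A' D : (forall l, W' l = W l) ->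
  (forall l, A' l = A l) -> covering W A D -> covering W' A' D.
Proof.
move=> eW eA [W0 W1 cost subD freeD].
have em h : mix W' A' h = mix W A h by apply: eq_mix => l _.
split=> [l ln||O OC|x l ln xD|x xD]; rewrite ?em ?eW ?eA //.
- exact: W0.
- exact: cost.
- exact: subD.
- exact: freeD.
Qed.

(** For the point mass at the empty set, the potential 2 E[f(. U O)] - E[f] equals 2 f(O) - f(0). *)
Lemma covering_init W A : (forall i, W i = (i == 0%N)%:R) ->
  (forall i, A i = set0) -> covering W A set0.
Proof.
move=> eW eA.
have mix0 h : mix W A h = h set0.
  rewrite /mix (bigD1 (ord0 : 'I_n.+1)) //= eW eA eqxx mul1r big1 ?addr0 //.
  by move=> i; rewrite -val_eqE eW => /negbTE /= ->; rewrite mul0r.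
split=> [l _||O _|x l _|x _]; rewrite ?mix0 ?set0U ?inE ?eW //.
Qed.

(** The potential is at least E[f], since f(X U O) >= f(X), and E[f] >= f(D), since D lies in every
    layer. *)
Lemma covering_le W A D O : covering W A D -> O \in vertex_covers e ->
  f D <= 2 * f O.
Proof.
case=> W0 W1 cost subD _ /cost le_cost.
have : f D <= mix W A f.
  rewrite -[leLHS]mulr1 -W1 /mix mulr_sumr; apply: ler_sum => l _.
  have ln : (l <= n)%N by rewrite -ltnS.
  rewrite mulr1 mulrC ler_wpM2l ?W0 // f_mono //.
  by apply/subsetP => x; apply: subD.
have : mix W A f <= mix W A (fun X => f (X :|: O)).
  by apply: le_mix => // l _; rewrite f_mono ?subsetUl.
have := f_ge0 set0; lra.
Qed.

(** * Treating one edge: spending g_p on q, then adding p everywhere *)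

Section Raise.

Variables (W0 : nat -> R) (A0 : nat -> {set 'I_n}) (D : {set 'I_n}).
Variables (p q : 'I_n).
Hypotheses (cover0 : covering W0 A0 D) (pD : p \notin D).

(* b is the part of the budget [gain W0 A0 p] that is not yet spent on q. *)
Record raising (i : nat) W A (b : R) : Prop := Raising {
  raising_ge0 : forall l, (l <= n)%N -> 0 <= W l;
  raising_anti : forall h, (forall X, h (X :|: [set q]) <= h X) ->
    mix W A h <= mix W0 A0 h;
  raising_spent : mix W A f + b = mix W0 A0 f + gain W0 A0 p;
  raising_b : 0 <= b;
  raising_unspent : 0 < b ->
    W p.+1 = 0 /\ forall l, (l < i)%N -> q \in A l;
  raising_sub : forall x l, (l <= n)%N -> x \in D -> x \in A l;
  raising_free : forall x : 'I_n, x \notin D -> x != p -> W x.+1 = 0 }.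

Lemma raising_init W A : (forall i, W i = W0 i) -> (forall i, A i = A0 i) ->
  raising 0 W A (gain W0 A0 p).
Proof.
move=> eW eA; have em h : mix W A h = mix W0 A0 h by apply: eq_mix => l _.
case: cover0 => W00 _ _ subD freeD.
split=> [l ln|h _||||x l|x xD _]; rewrite ?em ?eW ?eA //; try exact: W00.
- exact: gain_ge0.
- by split=> //; apply: freeD.
- exact: subD.
- exact: freeD.
Qed.

(** The whole layer takes q when its marginal cost fits the budget. The clause [raising_anti]
    expresses that sets have only been enlarged by q: this lowers every expectation of a function
    that q can only decrease. *)
Lemma raising_add i W A W' A' b :
  (i <= n)%N -> raising i W A b ->
  W i * (f (A i :|: [set q]) - f (A i)) <= b ->
  (forall l, W' l = W l) ->
  (forall l, A' l = if l == i then A i :|: [set q] else A l) ->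
  raising i.+1 W' A' (b - W i * (f (A i :|: [set q]) - f (A i))).
Proof.
move=> le_in [Wge0 anti spent b0 unspent subD freeD]; set d := _ * _ => le_db.
move=> eW eA.
have em h : mix W' A' h = mix W A h + W i * (h (A i :|: [set q]) - h (A i)).
  by rewrite -(@mix_add _ _ _ _ A') // => *; apply: eq_mix.
have d_ge0 : 0 <= d by rewrite mulr_ge0 ?Wge0 ?subr_ge0 ?f_mono ?subsetUl.
split=> [l ln|h hq|||b_gt0|x l ln xD|x xD xp]; rewrite ?eW ?eA //.
- exact: Wge0.
- apply: le_trans (anti h hq); rewrite em gerDl.
  by rewrite mulr_ge0_le0 ?Wge0 // subr_le0.
- by rewrite em -/d -spent; lra.
- by rewrite subr_ge0.
- have [Wp qA] : _ := unspent ltac:(lra); split=> // l; rewrite eA ltnS.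
  case: eqVneq => [->|li le_li]; first by rewrite !inE eqxx orbT.
  by apply: qA; rewrite ltn_neqAle li.
- by case: ifP => [/eqP <-|_]; rewrite ?inE subD.
- exact: freeD.
Qed.

(** Once the budget is exhausted, [raising_unspent] is vacuous and a layer may stay without q. *)
Lemma raising_skip i W A W' A' b : raising i W A b -> b <= 0 ->
  (forall l, W' l = W l) -> (forall l, A' l = A l) ->
  raising i.+1 W' A' b.
Proof.
move=> [Wge0 anti spent b0 unspent subD freeD] b_le0 eW eA.
have em h : mix W' A' h = mix W A h by apply: eq_mix.
split=> [l ln|h hq|||b_gt0|x l ln xD|x xD xp]; rewrite ?eW ?eA ?em //.
- exact: Wge0.
- exact: anti.
- by move: b_gt0; rewrite ltNge b_le0.
- exact: subD.
- exact: freeD.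
Qed.

(** While the budget is positive, layer p.+1 has weight 0, so its marginal cost cannot exceed the
    budget. A split therefore has distinct source and target. *)
Lemma raising_split_neq i W A b : raising i W A b -> 0 < b ->
  b < W i * (f (A i :|: [set q]) - f (A i)) -> i != p.+1.
Proof.
move=> rW b_gt0; have [Wp _] := raising_unspent rW b_gt0.
by apply: contraTneq => ->; rewrite Wp mul0r -leNgt ltW.
Qed.

(** The fraction b / d costs exactly b. The budget becomes 0, so no second split can claim layer
    p.+1. *)
Lemma raising_split i W A W' A' b (d := W i * (f (A i :|: [set q]) - f (A i))) :
  (i <= n)%N -> raising i W A b -> 0 < b -> b < d ->
  (forall l, W' l = if l == i then W i * (b / d) else
                    if l == p.+1 then W i * (1 - b / d) else W l) ->
  (forall l, A' l = if l == i then A i :|: [set q] else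
                    if l == p.+1 then A i else A l) ->
  raising i.+1 W' A' 0.
Proof.
move=> le_in rW b_gt0 lt_bd eW eA.
have ip := raising_split_neq rW b_gt0 lt_bd.
case: rW => [Wge0 anti spent b0 unspent subD freeD].
have [Wp _] := unspent b_gt0.
have em h : mix W' A' h =
    mix W A h + b / d * (W i * (h (A i :|: [set q]) - h (A i))).
  exact: (@mix_split _ _ W A W' A' h i p.+1).
have d_gt0 : 0 < d by apply: lt_trans lt_bd.
have t0 : 0 <= b / d by rewrite divr_ge0 // ltW.
have t1 : b / d <= 1 by rewrite ler_pdivrMr // mul1r ltW.
split=> [l ln|h hq||||x l ln xD|x xD xp]; rewrite ?ltxx // ?eW ?eA //.
- case: ifP => _; first by rewrite mulr_ge0 ?Wge0.
  by case: ifP => _; rewrite ?mulr_ge0 ?Wge0 // subr_ge0.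
- apply: le_trans (anti h hq); rewrite em gerDl.
  by rewrite mulr_ge0_le0 // mulr_ge0_le0 ?Wge0 // subr_le0.
- by rewrite em -/d divfK ?gt_eqF // addr0.
- case: ifP => [/eqP <-|_]; first by rewrite inE subD.
  by case: ifP => _; rewrite subD.
- have Wx := freeD x xD xp.
  case: eqVneq => [xi|_]; last by rewrite eqSS (negbTE (xp : (x != p :> nat))).
  by move: lt_bd; rewrite /d -xi Wx mul0r ltNge ltW.
Qed.

(** With budget left, all layers contain q, so E[f] has grown by at least g_q >= g_p; but it has
    grown by only g_p - b. *)
Lemma raising_done W A b : gain W0 A0 p <= gain W0 A0 q ->
  raising n.+1 W A b -> b = 0.
Proof.
move=> le_pq [Wge0 anti spent b0 unspent subD freeD].
apply/eqP; rewrite eq_le b0 andbT leNgt; apply/negP => b_gt0.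
have [_ qA] := unspent b_gt0.
have mq : mix W A (fun X => f (X :|: [set q])) = mix W A f.
  apply: eq_bigr => l _; congr (_ * f _); apply/setUidPl.
  by rewrite sub1set qA.
(* This function is insensitive to q, so [raising_anti] applies to it and bounds E[f(. U q)] from
   below. *)
have := anti (fun X => - f (X :|: [set q])).
rewrite !mixN mq.
have idq X : - f (X :|: [set q] :|: [set q]) <= - f (X :|: [set q]).
  by rewrite -setUA setUid.
move=> /(_ idq); move: le_pq; rewrite /gain; move: spent; rewrite /gain; lra.
Qed.

(** The potential is 2 (E[f(. U O)] - E[f]) + E[f]. The bracket drops by at least g_p, whichever
    endpoint O contains, and the last term grows by at most 2 g_p. *)
Lemma covering_raise W A W' A' b : e p q ->
  gain W0 A0 p <= gain W0 A0 q -> raising n.+1 W A b ->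
  (forall l, W' l = W l) ->
  (forall l, (l <= n)%N -> A' l = A l :|: [set p]) ->
  covering W' A' (D :|: [set p]).
Proof.
move=> epq le_pq rW eW eA.
have b0 := raising_done le_pq rW; move: rW; rewrite b0 {b b0}.
case=> Wge0 anti spent _ _ subD freeD.
have em h : mix W' A' h = mix W A (fun X => h (X :|: [set p])).
  by apply: eq_bigr => l _; rewrite eW eA // -ltnS.
case: cover0 => W00 sum0 cost0 sub0 free0.
(* By submodularity f(Z U X) - f(Z U Y) decreases as Z grows, so it may be used in
   [raising_anti]. *)
have antiU (X Y : {set 'I_n}) : Y \subset X ->
    mix W A (fun Z => f (Z :|: X)) - mix W A (fun Z => f (Z :|: Y)) <=
    mix W0 A0 (fun Z => f (Z :|: X)) - mix W0 A0 (fun Z => f (Z :|: Y)).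
  move=> sYX; rewrite -!mixB; apply: anti => Z.
  have sub : Z :|: Y \subset Z :|: [set q] :|: Y by rewrite setSU ?subsetUl.
  have := submodular_marginal f_mono f_sub X sub.
  by rewrite -!setUA (setUidPr sYX).
have mix_U0 W1 A1 : mix W1 A1 (fun Z => f (Z :|: set0)) = mix W1 A1 f.
  by apply: eq_bigr => l _; rewrite setU0.
have lep := antiU _ _ (sub0set [set p]); rewrite !mix_U0 in lep.
split=> [l ln||O OC|x l ln|x]; rewrite ?eW ?em.
- exact: Wge0.
(* Total mass is preserved: the constants 1 and -1 give the two inequalities. *)
- have le1 := anti (fun=> 1) (fun=> lexx _).
  have := anti (fun=> - 1) (fun=> lexx _); rewrite !(mixN _ _ (fun=> 1)) lerN2.
  by move: le1; rewrite sum0 => le1 ge1; apply/eqP; rewrite eq_le le1.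
- apply: le_trans (cost0 O OC).
  move: OC; rewrite inE => /forallP/(_ p)/forallP/(_ q)/implyP/(_ epq).
  case/orP => [pO|qO].
    have -> : mix W A (fun X => f (X :|: [set p] :|: O)) =
        mix W A (fun X => f (X :|: O)).
      apply: eq_bigr => l _; rewrite -setUA; congr (_ * f (_ :|: _)).
      by apply/setUidPr; rewrite sub1set.
    have := antiU O [set p]; rewrite sub1set => /(_ pO).
    move: lep spent; rewrite /gain; lra.
  have : mix W A (fun X => f (X :|: O)) <= mix W0 A0 (fun X => f (X :|: O)).
    apply: anti => X; rewrite -setUA (_ : _ :|: O = O) //.
    by apply/setUidPr; rewrite sub1set.
  have : mix W A (fun X => f (X :|: [set p] :|: O)) -
      mix W A (fun X => f (X :|: [set p])) <=
      mix W A (fun X => f (X :|: O)) - mix W A f.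
    rewrite -!mixB; apply: le_mix => // l _.
    exact: submodular_marginal (subsetUl _ _).
  move: lep spent; rewrite /gain; lra.
- by rewrite eA // !inE => /orP[/(subD _ _ ln) ->|->]; rewrite ?orbT.
- by rewrite !inE negb_or => /andP[xD xp]; apply: freeD.
Qed.

End Raise.

End CoverInvariant.

(** * The program *)

Local Notation "p ;; q" := (PSeq p q) (at level 60, right associativity).
Local Notation n0 := (NLit 0).
Local Notation n1 := (NLit 1).

(* Natural-number arrays: 4[0, v] != 0 when v is saturated, that is, v belongs
   to all the A_l; 5 holds the singletons; row l of 6 is A_l.  Scalars: 7 and 8
   are the current pair of vertices, 9 is l, 10 and 11 are p and q, 12 and 13
   are scratch cells, and 14 is a rank.
   Real arrays: 0[0, l] is W_l, 1[0, v] is f({v}), 2 and 3 hold an oracle answer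
   and a marginal value, 6 is g_q, and 5 is g_p, then the part of g_p that
   remains to be spent on q. *)
Definition marginal (x : nat) : prog :=
  PSetN 12 n0 n0 (NGet 6 (nvar 9) (nvar x)) ;;
  PQuery 2 n0 n0 6 (nvar 9) ;;
  PSetN 6 (nvar 9) (nvar x) n1 ;;
  PQuery 3 n0 n0 6 (nvar 9) ;;
  PSetN 6 (nvar 9) (nvar x) (nvar 12) ;;
  PSetR 3 n0 n0 (RMul (RGet 0 n0 (nvar 9)) (RSub (rvar 3) (rvar 2))).

(** The offset 1 in the loop makes it visit all n + 1 layers. *)
Definition gains (x g : nat) : prog :=
  PSetR g n0 n0 (RLit 0) ;;
  PFor 9 1 (marginal x ;; PSetR g n0 n0 (RAdd (rvar g) (rvar 3))).

Definition copy : prog :=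
  PFor 13 0
    (PSetN 6 (NAdd (nvar 10) n1) (nvar 13) (NGet 6 (nvar 9) (nvar 13))).

(** The order matters: the layer is copied before it receives q, and the new layer's weight is
    computed before the old weight is overwritten. *)
Definition split : prog :=
  copy ;;
  PSetR 0 n0 (NAdd (nvar 10) n1)
    (RMul (RGet 0 n0 (nvar 9)) (RSub (RLit 1) (RDiv (rvar 5) (rvar 3)))) ;;
  PSetR 0 n0 (nvar 9) (RMul (RGet 0 n0 (nvar 9)) (RDiv (rvar 5) (rvar 3))) ;;
  PSetN 6 (nvar 9) (nvar 11) n1 ;;
  PSetR 5 n0 n0 (RLit 0).

(** A split happens only when the marginal value in 3 exceeds a positive budget, so its divisions
    are by a positive number. *)
Definition raise : prog :=
  PFor 9 1
    (marginal 11 ;;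
     PIf (BLeR (rvar 3) (rvar 5))
       (PSetN 6 (nvar 9) (nvar 11) n1 ;;
        PSetR 5 n0 n0 (RSub (rvar 5) (rvar 3)))
       (PIf (BLeR (rvar 5) (RLit 0)) PSkip split)).

Definition saturate : prog :=
  PFor 9 1 (PSetN 6 (nvar 9) (nvar 10) n1) ;;
  PSetN 4 n0 (nvar 10) n1.

Definition process : prog :=
  PSetN 10 n0 n0 (nvar 7) ;;
  PSetN 11 n0 n0 (nvar 8) ;;
  gains 10 5 ;;
  gains 11 6 ;;
  PIf (BLeR (rvar 5) (rvar 6)) PSkip
    (PSetN 10 n0 n0 (nvar 8) ;;
     PSetN 11 n0 n0 (nvar 7) ;;
     PSetR 5 n0 n0 (rvar 6)) ;;
  raise ;;
  saturate.

(** One pass suffices: vertices stay saturated, so a pair once covered remains covered. *)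
Definition scan : prog :=
  PFor 7 0 (PFor 8 0
    (PIf (BAnd (BLeN n1 (NGet 2 (nvar 7) (nvar 8)))
           (BAnd (BLeN (NGet 4 n0 (nvar 7)) n0)
              (BLeN (NGet 4 n0 (nvar 8)) n0)))
       process PSkip)).

Definition singletons : prog :=
  PFor 7 0
    (PSetN 5 (nvar 7) (nvar 7) n1 ;; PQuery 1 n0 (nvar 7) 5 (nvar 7)).

(** The test is [precedes], with its disjunction and strict real comparison rewritten by
    negations. *)
Definition count_preceding : prog :=
  PSetN 14 n0 n0 n0 ;;
  PFor 8 0
    (PIf (BNot (BAnd (BLeR (RGet 1 n0 (nvar 7)) (RGet 1 n0 (nvar 8)))
                  (BNot (BAnd
                     (BLeR (RGet 1 n0 (nvar 8)) (RGet 1 n0 (nvar 7)))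
                     (BLeN (NAdd (nvar 8) n1) (nvar 7))))))
       (PSetN 14 n0 n0 (NAdd (nvar 14) n1)) PSkip).

(** The truncated difference of k and the rank is positive exactly when the rank is below k; adding
    the saturation mark to it encodes a disjunction. *)
Definition place : prog :=
  PFor 7 0
    (count_preceding ;;
     PIf (BLeN (NAdd (nvar 14) (NLit 2)) (nvar 1))
       (PSetN 3 (nvar 14) (nvar 7) n1)
       (PIf (BLeN n1 (NAdd (NGet 4 n0 (nvar 7)) (NSub (nvar 1) (nvar 14))))
          (PSetN 3 (NSub (nvar 1) n1) (nvar 7) n1) PSkip)).

Definition partition_cover : prog :=
  singletons ;; PSetR 0 n0 n0 (RLit 1) ;; scan ;; place.

(** * Cost of the partition *)

Section Partition.

Variables (R : realType) (n : nat) (f : {set 'I_n} -> R) (e : rel 'I_n).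
Hypotheses (f_ge0 : nonnegative f) (f_mono : monotone f).
Hypothesis (f_sub : submodular f).
Variable k : nat.
Hypotheses (k_gt0 : (0 < k)%N) (le_kn : (k <= n)%N).
Variable C : {set 'I_n}.

Local Notation rk := (rank (fun v => f [set v])).

(** Rows count from 0: ranks 0, ..., k-2 get their own rows, and row k-1 takes the vertex of rank
    k-1 with the vertices of C of larger rank. *)
Definition part (i : nat) (v : 'I_n) : bool :=
  if (rk v + 2 <= k)%N then i == rk v
  else (i == k - 1)%N && ((rk v < k)%N || (v \in C)).

Definition parts (i : 'I_k) : {set 'I_n} := [set v | part i v].

Lemma parts_feasible : C \in vertex_covers e -> feasible e parts.
Proof.
move=> C_cover; split=> [i j ij||i].
- rewrite -setI_eq0; apply/eqP/setP => v; rewrite !inE /part.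
  apply/negP; case: ifP => _ /andP[].
    by move=> /eqP iv /eqP jv; case/eqP: ij; apply: val_inj; rewrite /= iv jv.
  move=> /andP[/eqP iv _] /andP[/eqP jv _].
  by case/eqP: ij; apply: val_inj; rewrite /= iv jv.
- have sub : C \subset \bigcup_i parts i.
    apply/subsetP => v vC; apply/bigcupP.
    case: (leqP (rk v + 2) k) => rv.
      have ik : (rk v < k)%N by lia.
      by exists (Ordinal ik); rewrite // inE /part rv /= eqxx.
    have ik : (k - 1 < k)%N by lia.
    by exists (Ordinal ik); rewrite // inE /part leqNgt rv /= eqxx vC orbT.
  move: C_cover; rewrite !inE => /forallP Cc; apply/forallP => u.
  apply/forallP => v; apply/implyP => euv.
  have /forallP/(_ v)/implyP/(_ euv) := Cc u.
  by case/orP => /(subsetP sub) ->; rewrite ?orbT.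
- have [v rv] := rank_surj (fun v => f [set v]) (leq_trans (ltn_ord i) le_kn).
  apply/set0Pn; exists v; rewrite inE /part rv ltn_ord; case: ifPn => //.
  by rewrite andbT; have := ltn_ord i; lia.
Qed.

Lemma cost_parts_le (B : R) :
  (forall O, O \in vertex_covers e -> f C <= B * f O) -> 0 <= B ->
  forall T : 'I_k -> {set 'I_n}, feasible e T ->
  cost f parts <= (B + 1) * cost f T.
Proof.
move=> C_approx B_ge0 T [T_disj T_cover T_n0].
have [r rP] : exists r : 'I_k -> 'I_n, forall i, rk (r i) = i.
  have /fin_all_exists[r rP] : forall i : 'I_k, exists v, rk v = i.
    by move=> i; apply: rank_surj; apply: leq_trans le_kn.
  by exists r.
have last_lt : (k - 1 < k)%N by lia.
pose z := Ordinal last_lt.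
have le_parts i : f (parts i) <= f [set r i] + (if i == z then f C else 0).
  case: eqP => [->|iz]; rewrite ?addr0.
    apply: le_trans (subadditive f_ge0 f_mono f_sub _ _); apply: f_mono.
    apply/subsetP => v; rewrite !inE /part; case: ifP => rv.
      by move=> /eqP /=; lia.
    case/andP => _ /orP[rvk|->]; last by rewrite orbT.
    apply/orP; left; apply/eqP; apply: (@rank_inj _ _ (fun v => f [set v])).
    by rewrite rP /=; lia.
  apply: f_mono; apply/subsetP => v; rewrite !inE /part; case: ifP => rv.
    move=> /eqP iv; apply/eqP; apply: (@rank_inj _ _ (fun v => f [set v])).
    by rewrite rP -iv.
  by move=> /andP[/eqP ik _]; case: iz; apply: val_inj.
(* Disjointness makes representatives t i of the parts distinct, so their singleton values sum to at
   least the k smallest ones. *)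
have sum_r : \sum_i f [set r i] <= cost f T.
  have /fin_all_exists[t tT] i : exists v, v \in T i by apply/set0Pn.
  have t_inj : injective t.
    move=> i j tij; apply/eqP; apply: contraT => /T_disj.
    by move/disjointFr => /(_ _ (tT i)); rewrite tij tT.
  have r_inj : injective r.
    by move=> i j rij; apply: val_inj; rewrite /= -!rP rij.
  have -> : \sum_i f [set r i] = \sum_(v | (rk v < k)%N) f [set v].
    rewrite -(big_imset (fun v => f [set v]) (in2W r_inj)) /=.
    apply: eq_bigl => v; apply/imsetP/idP => [[i _ ->]|rv]; first by rewrite rP.
    exists (Ordinal rv) => //.
    by apply: (@rank_inj _ _ (fun v => f [set v])); rewrite rP.
  have card_t : #|t @: 'I_k| = k by rewrite card_imset // card_ord.
  apply: le_trans (sum_rank_le _ le_kn card_t) _.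
  rewrite big_imset /=; last exact: in2W.
  by apply: ler_sum => i _; rewrite f_mono // sub1set.
have le_cost : f (\bigcup_i T i) <= cost f T.
  by apply: bigcup_le_sum; rewrite ?card_ord.
apply: (@le_trans _ _ (\sum_i (f [set r i] + (if i == z then f C else 0)))).
  exact: ler_sum.
rewrite big_split /= -big_mkcond big_pred1_eq addrC mulrDl mul1r lerD //.
by apply: le_trans (C_approx _ T_cover) _; rewrite ler_wpM2l.
Qed.

End Partition.

(** * Correctness of the program *)

Section Verification.

Variables (R : realType) (n : nat) (f : {set 'I_n} -> R).
Implicit Types (s : state R).

Local Notation run := (run f).

Definition layer s (l : nat) : {set 'I_n} := rowset n s 6 l.
Definition weight s (l : nat) : R := rmem s 0 0 l.

Lemma eq_rowset s s' a a' i i' :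
  (forall j, nmem s' a' i' j = nmem s a i j) ->
  rowset n s' a' i' = rowset n s a i.
Proof. by move=> eqm; apply/setP => v; rewrite !inE eqm. Qed.

Lemma rowset_add s s' a i (v : 'I_n) (b : bool) :
  (forall j, nmem s' a i j = if (b && (j == v)) then 1%N else nmem s a i j) ->
  rowset n s' a i = if b then rowset n s a i :|: [set v] else rowset n s a i.
Proof.
move=> eqm; apply/setP => w; rewrite !inE eqm.
case: b {eqm} => /=; last by rewrite inE.
rewrite !inE (inj_eq val_inj); by case: (w == v); rewrite ?orbT ?orbF.
Qed.

Lemma run_marginal x s (v : 'I_n) l :
  x != 6%N -> x != 12%N -> nmem s x 0 0 = v -> nmem s 9 0 0 = l ->
  let s' := run (marginal x) s in
  [/\ forall a i j, a != 12%N -> nmem s' a i j = nmem s a i j,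
      forall a i j, a != 2%N -> a != 3%N -> rmem s' a i j = rmem s a i j &
      rmem s' 3 0 0 = weight s l * (f (layer s l :|: [set v]) - f (layer s l))].
Proof.
move=> x6 x12 xv sl s'.
(* The oracle reads only rows, so the vertex is written into the layer for the second query; the
   saved entry is then put back. *)
have n6 i j : nmem s' 6 i j = nmem s 6 i j.
  rewrite /s' /= /setn /setr /upd /= ?sl ?xv ?(negbTE x6) ?(negbTE x12) /=.
  by case: andP => // -[/eqP -> /eqP ->].
split=> [a i j a12|a i j a2 a3|].
- case: (eqVneq a 6%N) => [->|a6]; first exact: n6.
  by rewrite nmem_run //= !(eq_sym _ a) a6 a12.
- by rewrite rmem_run //= !(eq_sym _ a) a2 a3.
- rewrite /s' /= /setn /setr /upd /= ?sl ?xv ?(negbTE x6) ?(negbTE x12) /=.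
  congr (_ * (f _ - f _)); apply: (rowset_add (b := true)) => j /=.
  by rewrite eqxx.
Qed.

Lemma run_gains x g s (v : 'I_n) :
  x \notin [:: 6; 9; 12]%N -> g \notin [:: 0; 2; 3]%N ->
  nmem s 0 0 0 = n -> nmem s x 0 0 = v ->
  let s' := run (gains x g) s in
  [/\ forall a i j, a \notin [:: 9; 12]%N -> nmem s' a i j = nmem s a i j,
      forall a i j, a \notin [:: 2; 3; g]%N -> rmem s' a i j = rmem s a i j &
      rmem s' g 0 0 = gain f (weight s) (layer s) v].
Proof.
rewrite !inE !negb_or => /and3P[x6 x9 x12] /and3P[g0 g2 g3] sn xv.
pose I i s1 := [/\
  forall a i j, a \notin [:: 9; 12]%N -> nmem s1 a i j = nmem s a i j,
  forall a i j, a \notin [:: 2; 3; g]%N -> rmem s1 a i j = rmem s a i j &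
  rmem s1 g 0 0 = \sum_(l < i) weight s l *
    (f (layer s l :|: [set v]) - f (layer s l))].
suff [h1 h2 h3] : I (n + 1)%N (run (gains x g) s).
  by split=> //; rewrite h3 addn1 /gain -mixB.
rewrite /gains run_PSeq; apply: (run_PFor (I := I)) => //.
- split=> [a i j|a i j|]; rewrite ?big_ord0 /= /upd ?eqxx //.
    by rewrite !inE negb_or; case: eqP.
  by rewrite !inE !negb_or; case: (a == g) => //=; rewrite !andbF.
move=> i s1 le_in s1i [N1 R1 g1].
have s1x : nmem s1 x 0 0 = v by rewrite N1 ?xv // !inE negb_or x9.
have [N2 R2 r3] := run_marginal x6 x12 s1x s1i.
rewrite run_PSeq; move: (run _ s1) N2 R2 r3 => s2 N2 R2 r3.
split=> [a j m|a j m|] /=; rewrite /upd.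
- rewrite !inE !negb_or => /andP[a9 a12].
  by rewrite (negbTE a9) N2 // N1 // !inE negb_or a9.
- rewrite !inE !negb_or => /and3P[a2 a3 ag].
  by rewrite (negbTE ag) (R2 a) // (R1 a) // !inE !negb_or a2 a3.
- rewrite !eqxx big_ord_recr /= R2 // g1 r3.
  congr (_ + _ * (f _ - f _)); rewrite /weight /layer.
  + by rewrite R1 // !inE !negb_or (eq_sym _ g) g0.
  + by congr (_ :|: _); apply: eq_rowset => j; rewrite N1.
  + by apply: eq_rowset => j; rewrite N1.
Qed.

Lemma run_copy s (p : 'I_n) l :
  nmem s 0 0 0 = n -> nmem s 10 0 0 = p -> nmem s 9 0 0 = l -> l != p.+1 ->
  forall i, layer (run copy s) i = if i == p.+1 then layer s l else layer s i.
Proof.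
move=> sn sp sl lp i.
pose I m s1 := [/\ nmem s1 10 0 0 = p, nmem s1 9 0 0 = l &
  forall i j, nmem s1 6 i j =
    if (i == p.+1) && (j < m)%N then nmem s 6 l j else nmem s 6 i j].
suff [_ _ s6] : I (n + 0)%N (run copy s).
  apply/setP => v; rewrite !inE s6 addn0 ltn_ord andbT.
  by case: (i == p.+1); rewrite inE.
apply: (run_PFor (I := I)) => //; first by split=> // m j; rewrite andbF.
move=> m s1 lt_mn s1m [s1p s1l s16]; split=> // i' j.
rewrite /= /upd /= s1p s1l s1m addn1 !s16 (negbTE lp) /= ltnS.
by case: (i' == p.+1) => //=; case: (ltngtP j m) => //= ->.
Qed.

Lemma run_raise s (D : {set 'I_n}) (p q : 'I_n) e (s' := run raise s) :
  monotone f -> nmem s 0 0 0 = n -> nmem s 10 0 0 = p -> nmem s 11 0 0 = q ->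
  covering f e (weight s) (layer s) D -> p \notin D ->
  rmem s 5 0 0 = gain f (weight s) (layer s) p ->
  raising f (weight s) (layer s) D p q n.+1 (weight s') (layer s')
    (rmem s' 5 0 0).
Proof.
move=> f_mono sn sp sq cov pD s5.
pose I m s1 := [/\ nmem s1 0 0 0 = n, nmem s1 10 0 0 = p, nmem s1 11 0 0 = q &
  raising f (weight s) (layer s) D p q m (weight s1) (layer s1)
    (rmem s1 5 0 0)].
suff : I (n + 1)%N s' by rewrite addn1; case.
apply: (run_PFor (I := I)) => //.
  by split=> //=; rewrite s5; exact: (raising_init f_mono q cov pD).
move=> i s1; rewrite addn1 ltnS => le_in s1i [s1n s1p s1q rs1].
have [N2 R2 r3] := @run_marginal 11 s1 q i isT isT s1q s1i.
rewrite run_PSeq; move: (run _ s1) N2 R2 r3 => s2 N2 R2 r3.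
have W2 l : weight s2 l = weight s1 l by apply: R2.
have A2 l : layer s2 l = layer s1 l by apply: eq_rowset => j; rewrite N2.
have s2n : nmem s2 0 0 0 = n by rewrite N2.
have s2p : nmem s2 10 0 0 = p by rewrite N2.
have s2q : nmem s2 11 0 0 = q by rewrite N2.
have s2i : nmem s2 9 0 0 = i by rewrite N2.
have s25 : rmem s2 5 0 0 = rmem s1 5 0 0 by rewrite R2.
rewrite !run_PIf ![beval _ _]/= s25 r3.
have addA s3 l : (forall l j, nmem s3 6 l j =
      if (l == i) && (j == q) then 1%N else nmem s2 6 l j) ->
    layer s3 l = if l == i then layer s1 i :|: [set q] else layer s1 l.
  move=> eq6; rewrite /layer (@rowset_add s2 s3 6 l q (l == i)) //.
  by case: eqP => [->|_]; rewrite [rowset _ s2 _ _]A2.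
case: ifPn => [le_d|]; last rewrite -ltNge => lt_d.
  split=> //; rewrite [run _ _]/= s25 r3.
  apply: (raising_add f_mono le_in rs1 le_d) => l; first exact: W2.
  by apply: addA => l' j; rewrite /= /upd s2i s2q.
case: ifPn => [b_le0|]; last rewrite -ltNge => b_gt0.
  by split=> //=; rewrite s25; exact: (raising_skip rs1 b_le0 W2 A2).
have ip := raising_split_neq rs1 b_gt0 lt_d.
rewrite /split run_PSeq; have A3 := run_copy s2n s2p s2i ip.
move: (run copy s2) A3 (@nmem_run _ _ f copy s2) (@rmem_run _ _ f copy s2).
move=> s3 A3 N3 R3.
have s3n : nmem s3 0 0 0 = n by rewrite N3.
have s3p : nmem s3 10 0 0 = p by rewrite N3.
have s3q : nmem s3 11 0 0 = q by rewrite N3.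
have s3i : nmem s3 9 0 0 = i by rewrite N3.
have W3 l : rmem s3 0 0 l = weight s1 l by rewrite R3 // [LHS]W2.
have s35 : rmem s3 5 0 0 = rmem s1 5 0 0 by rewrite R3.
have s33 : rmem s3 3 0 0 = rmem s2 3 0 0 by rewrite R3.
split; [exact: s3n | exact: s3p | exact: s3q |]; set s4 := setn _ 9 _ _ _.
have -> : rmem s4 5 0 0 = 0 by [].
apply: (raising_split le_in rs1 b_gt0 lt_d) => l.
  rewrite /s4 /weight /= /upd /= s3p s3i s35 s33 r3 !W3 addn1.
  by rewrite (negbTE ip).
rewrite /layer (@rowset_add s3 s4 6 l q (l == i)) => [|j]; last first.
  by rewrite /s4 /= /upd /= s3i s3q.
case: eqP => [->|_]; rewrite [rowset _ s3 _ _]A3 !A2 //.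
by rewrite (negbTE ip).
Qed.

(** * Processing the edges and obtaining a cover *)

Definition saturated s : {set 'I_n} := rowset n s 4 0.

Lemma run_saturate s (p : 'I_n) (s' := run saturate s) :
  nmem s 0 0 0 = n -> nmem s 10 0 0 = p ->
  [/\ saturated s' = saturated s :|: [set p], forall l, weight s' l = weight s l
    & forall l, (l <= n)%N -> layer s' l = layer s l :|: [set p]].
Proof.
move=> sn sp; pose c := PFor 9 1 (PSetN 6 (nvar 9) (nvar 10) n1).
have s'E : s' = setn (run c s) 4 0 (nmem (run c s) 10 0 0) 1 by [].
have [N1 R1] := (@nmem_run _ _ f c s, @rmem_run _ _ f c s).
pose I m s1 := nmem s1 10 0 0 = p /\ forall i j, nmem s1 6 i j =
    if (i < m)%N && (j == p) then 1%N else nmem s 6 i j.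
have [_ s6] : I (n + 1)%N (run c s).
  apply: (run_PFor (I := I)) => // m s1 lt_m s1m [s1p s16]; split=> // i j.
  rewrite /= /upd /= s1p s1m s16 ltnS.
  by case: ltngtP => //= ->; case: (j == p).
have c10 : nmem (run c s) 10 0 0 = p by rewrite N1.
split=> [|l|l le_ln].
- rewrite /saturated (@rowset_add s s' 4 0 p true) // => j.
  by rewrite s'E c10 /= /upd /= N1.
- by rewrite s'E /weight /= R1.
- rewrite /layer (@rowset_add s s' 6 l p true) // => j.
  by rewrite s'E /= /upd /= s6 addn1 ltnS le_ln.
Qed.

Lemma run_process e s (u v : 'I_n) (s' := run process s) :
  monotone f -> submodular f -> symmetric e -> e u v ->
  nmem s 0 0 0 = n -> nmem s 7 0 0 = u -> nmem s 8 0 0 = v ->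
  u \notin saturated s -> v \notin saturated s ->
  covering f e (weight s) (layer s) (saturated s) ->
  [/\ covering f e (weight s') (layer s') (saturated s'),
      saturated s \subset saturated s' &
      (u \in saturated s') || (v \in saturated s')].
Proof.
move=> f_mono f_sub e_sym euv sn su sv uD vD cov.
rewrite /s' /process 6!run_PSeq {s'}.
set s1 := run (PSetN 11 _ _ _) _.
have [N2 R2 g2] := @run_gains 10 5 s1 u isT isT sn su.
move: (run _ s1) N2 R2 g2 => s2 N2 R2 g2.
have {}g2 : rmem s2 5 0 0 = gain f (weight s) (layer s) u := g2.
have s2n : nmem s2 0 0 0 = n by rewrite N2.
have s2v : nmem s2 11 0 0 = v by rewrite N2.
have [N3 R3 g3] := @run_gains 11 6 s2 v isT isT s2n s2v.
move: (run _ s2) N3 R3 g3 => s3 N3 R3 g3.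
set s4 := run _ s3.
have gE : gain f (weight s2) (layer s2) v = gain f (weight s) (layer s) v.
  by apply: eq_gain => l _; [exact: R2 | apply: eq_rowset => j; rewrite N2].
(* In either branch p is the endpoint of smaller gain; symmetry of e allows the swap. *)
have [p [q [pD epq puv [le_pq]]]] : exists p q : 'I_n,
    [/\ p \notin saturated s, e p q, p = u \/ p = v &
    [/\ gain f (weight s) (layer s) p <= gain f (weight s) (layer s) q,
        rmem s4 5 0 0 = gain f (weight s) (layer s) p,
        nmem s4 10 0 0 = p & nmem s4 11 0 0 = q]].
  rewrite /s4 run_PIf [beval _ _]/= R3 // g2 g3 gE.
  case: ifPn => [le_uv|]; last rewrite -ltNge => /ltW le_vu.
    exists u, v; split; [by []|by []|by left|split=> //].
    - by rewrite R3.
    - by rewrite N3 // N2.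
    - by rewrite N3.
  exists v, u; split; [by []|by rewrite e_sym|by right|split=> //=].
  - by rewrite /upd /= g3.
  - by rewrite /upd /= !N3 ?N2.
  - by rewrite /upd /= !N3 ?N2.
move=> [s45 s4p s4q].
have N4 a i j : a \notin [:: 9; 10; 11; 12]%N -> nmem s4 a i j = nmem s a i j.
  rewrite !inE !negb_or => /and4P[a9 a10 a11 a12].
  rewrite nmem_run /= ?[10%N == a]eq_sym ?[11%N == a]eq_sym ?a10 ?a11 //.
  rewrite N3 ?inE ?negb_or ?a9 // N2 ?inE ?negb_or ?a9 //.
  by rewrite /s1 /= /upd (negbTE a10) (negbTE a11).
have W4 l : weight s4 l = weight s l.
  by rewrite /weight rmem_run // R3 // [LHS]R2.
have A4 l : layer s4 l = layer s l by apply: eq_rowset => j; rewrite N4.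
have D4 : saturated s4 = saturated s by apply: eq_rowset => j; rewrite N4.
have cov4 : covering f e (weight s4) (layer s4) (saturated s).
  exact: eq_covering cov.
have s4n : nmem s4 0 0 0 = n by rewrite N4.
have gE4 w : gain f (weight s4) (layer s4) w = gain f (weight s) (layer s) w.
  by apply: eq_gain => l _.
rewrite -gE4 in s45.
have r5 := run_raise f_mono s4n s4p s4q cov4 pD s45.
move: (run raise s4) r5 (@nmem_run _ _ f raise s4) => s5 r5 N5.
have s5n : nmem s5 0 0 0 = n by rewrite N5.
have s5p : nmem s5 10 0 0 = p by rewrite N5.
have [D6 W6 A6] := run_saturate s5n s5p.
have D5 : saturated s5 = saturated s.
  by rewrite -D4; apply: eq_rowset => j; rewrite N5.
rewrite D6 D5; split; last 2 first.
- exact: subsetUl.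
- by case: puv => ->; rewrite !inE eqxx ?orbT.
apply: covering_raise r5 W6 A6 => //.
by rewrite !gE4.
Qed.

Lemma run_scan e s (s' := run scan s) :
  monotone f -> submodular f -> symmetric e -> nmem s 0 0 0 = n ->
  (forall u v : 'I_n, nmem s 2 u v = e u v) ->
  covering f e (weight s) (layer s) (saturated s) ->
  covering f e (weight s') (layer s') (saturated s') /\
  saturated s' \in vertex_covers e.
Proof.
move=> f_mono f_sub e_sym sn se cov.
(* Every edge lexicographically before (i, j) has a saturated endpoint. *)
pose J i j s1 := [/\ nmem s1 0 0 0 = n,
  forall u v : 'I_n, nmem s1 2 u v = e u v,
  covering f e (weight s1) (layer s1) (saturated s1) &
  forall u v : 'I_n, e u v -> (u < i)%N || (u == i :> nat) && (v < j)%N ->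
    (u \in saturated s1) || (v \in saturated s1)].
suff [_ _ cov' sat] : J (n + 0)%N 0%N s'.
  split=> //; rewrite inE; apply/forallP => u; apply/forallP => v.
  by apply/implyP => /sat; apply; rewrite addn0 ltn_ord.
apply: (run_PFor (I := fun i => J i 0%N)) => //.
  by split=> // u v _; rewrite ltn0 andbF.
move=> i s1; rewrite addn0 => lt_in s1i J1.
pose I j s2 := nmem s2 7 0 0 = i /\ J i j s2.
set c := PFor 8 0 _.
suff [_ [s2n s2e cov2 sat2]] : I (n + 0)%N (run c s1).
  split=> // u v euv; rewrite ltn0 andbF orbF ltnS leq_eqVlt orbC => le_ui.
  by apply: sat2 => //; rewrite addn0 ltn_ord andbT.
apply: (run_PFor (I := I)) => //; first by case: J1.
move=> j s2; rewrite addn0 => lt_jn s2j [s2i [s2n s2e cov2 sat2]].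
pose u := Ordinal lt_in; pose v := Ordinal lt_jn.
have s2u : nmem s2 7 0 0 = u by [].
have s2v : nmem s2 8 0 0 = v by [].
have step s3 : nmem s3 0 0 0 = n -> nmem s3 7 0 0 = i ->
    (forall u v : 'I_n, nmem s3 2 u v = e u v) ->
    covering f e (weight s3) (layer s3) (saturated s3) ->
    saturated s2 \subset saturated s3 ->
    (e u v -> (u \in saturated s3) || (v \in saturated s3)) ->
    I j.+1 (setn s3 8 0 0 j.+1).
  move=> s3n s3i s3e cov3 sub sat3; split=> //; split=> // x y exy.
  rewrite ltnS [(y <= j)%N]leq_eqVlt andb_orr orbCA => /orP[|/sat2]; last first.
    by case/(_ exy)/orP => /(subsetP sub) h; rewrite ?h ?orbT //.
  case/andP => /eqP xi /eqP yj.
  have xu : x = u by apply: val_inj.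
  have yv : y = v by apply: val_inj.
  by move: exy; rewrite xu yv; apply: sat3.
rewrite run_PIf [beval _ _]/= s2u s2v s2e !leqn0.
have in_sat (w : 'I_n) : (nmem s2 4 0 w == 0%N) = (w \notin saturated s2).
  by rewrite inE negbK.
rewrite !in_sat; case: ifPn => [/and3P[euv uD vD]|no].
  have {}euv : e u v by move: euv; case: (e u v).
  have [cov3 sub sat3] :=
    run_process f_mono f_sub e_sym euv s2n s2u s2v uD vD cov2.
  by apply: step => //; try move=> *; rewrite nmem_run.
apply: step => // euv; move: no; rewrite euv /= negb_and !negbK.
by [].
Qed.

(** * Singleton values, ranks and placement of the vertices *)

Lemma run_singletons s (s' := run singletons s) :
  nmem s 0 0 0 = n -> (forall i j, nmem s 5 i j = 0%N) ->
  forall v : 'I_n, rmem s' 1 0 v = f [set v].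
Proof.
move=> sn s5 v.
pose I m s1 := (forall i j, nmem s1 5 i j = (i == j) && (i < m)%N) /\
  forall v : 'I_n, (v < m)%N -> rmem s1 1 0 v = f [set v].
suff [_ h] : I (n + 0)%N s' by rewrite h ?addn0.
apply: (run_PFor (I := I)) => //.
  by split=> // i j; rewrite andbF [LHS]s5.
move=> m s1 _ s1m [s15 s1r]; split=> [i j|w].
  rewrite /= /upd /= s1m s15 ltnS.
  case: (ltngtP i m) => [||->] /=; rewrite ?andbT ?andbF //.
  by rewrite eq_sym; case: eqP.
rewrite ltnS /= /upd /= s1m; case: ltngtP => //= [/s1r //|wm _].
congr f; apply/setP => x; rewrite !inE /= /upd /= eqxx s15 ltnn andbF.
by rewrite -wm (inj_eq val_inj); case: (x == w).
Qed.

Local Notation rk := (rank (fun v => f [set v])).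

Lemma run_count_preceding s (v : 'I_n) :
  nmem s 0 0 0 = n -> nmem s 7 0 0 = v ->
  (forall w : 'I_n, rmem s 1 0 w = f [set w]) ->
  nmem (run count_preceding s) 14 0 0 = rk v.
Proof.
move=> sn sv sf; rewrite /count_preceding run_PSeq.
pose P w := precedes (fun v => f [set v]) w v.
pose I m s1 := [/\ nmem s1 7 0 0 = v,
  forall w : 'I_n, rmem s1 1 0 w = f [set w] &
  nmem s1 14 0 0 = #|[set w : 'I_n | P w && (w < m)%N]|].
set c := PFor 8 0 _.
suff [_ _ ->] : I (n + 0)%N (run c (run (PSetN 14 n0 n0 n0) s)).
  by apply: eq_card => w; rewrite !inE addn0 ltn_ord andbT.
apply: (run_PFor (I := I)) => //.
  split=> //=; apply/esym/eqP; rewrite cards_eq0; apply/eqP/setP => w.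
  by rewrite !inE andbF.
move=> m s1; rewrite addn0 => lt_mn s1m [s1v s1f s1c].
pose w := Ordinal lt_mn; have s1w : nmem s1 8 0 0 = w by [].
have cardS : #|[set x : 'I_n | P x && (x < m.+1)%N]| =
    (P w + #|[set x : 'I_n | P x && (x < m)%N]|)%N.
  rewrite (cardsD1 w) inE ltnS leqnn andbT; congr (_ + _)%N.
  by apply: eq_card => x; rewrite !inE ltnS -val_eqE ltn_neqAle /= andbCA.
rewrite run_PIf [beval _ _]/= s1v s1w !s1f.
rewrite (_ : ~~ _ = P w); last first.
  by rewrite /P /precedes negb_and negbK -ltNge addn1.
case: ifPn => Pw; split=> //=; rewrite cardS -s1c.
  by rewrite /upd /= Pw addnC.
by rewrite (negbTE Pw).
Qed.

Lemma run_place k s (s' := run place s) : (0 < k)%N ->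
  nmem s 0 0 0 = n -> nmem s 1 0 0 = k ->
  (forall i j, nmem s 3 i j = 0%N) ->
  (forall w : 'I_n, rmem s 1 0 w = f [set w]) ->
  forall i, rowset n s' 3 i = [set v | part f k (saturated s) i v].
Proof.
move=> k_gt0 sn sk s3 sf i.
pose I m s1 := [/\ nmem s1 0 0 0 = n, nmem s1 1 0 0 = k,
  forall w : 'I_n, rmem s1 1 0 w = f [set w],
  forall j, nmem s1 4 0 j = nmem s 4 0 j &
  forall i (v : 'I_n), nmem s1 3 i v =
    (v < m)%N && part f k (saturated s) i v].
suff [_ _ _ _ h] : I (n + 0)%N s'.
  by apply/setP => v; rewrite !inE h addn0 ltn_ord; case: part.
apply: (run_PFor (I := I)) => //; first by split=> // j w; rewrite [LHS]s3.
move=> m s1; rewrite addn0 => lt_mn s1m [s1n s1k s1f s14 s13].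
pose v := Ordinal lt_mn; have s1v : nmem s1 7 0 0 = v by [].
rewrite run_PSeq; have c2 := run_count_preceding s1n s1v s1f.
move: (run _ s1) c2 (@nmem_run _ _ f count_preceding s1)
  (@rmem_run _ _ f count_preceding s1) => s2 c2 N2 R2.
have s2n : nmem s2 0 0 0 = n by rewrite N2.
have s2k : nmem s2 1 0 0 = k by rewrite N2.
have s2v : nmem s2 7 0 0 = v by rewrite N2.
have s2f (w : 'I_n) : rmem s2 1 0 w = f [set w] by rewrite R2.
have s24 j : nmem s2 4 0 j = nmem s 4 0 j by rewrite N2.
have s23 j (w : 'I_n) : nmem s2 3 j w = (w < m)%N && part f k (saturated s) j w.
  by rewrite N2.
(* The three branches touch array 3 at most in column v, so only that column has to be checked. *)
have step t :
    (forall a b c, a \notin [:: 3; 7]%N -> nmem t a b c = nmem s2 a b c) ->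
    (forall w : 'I_n, rmem t 1 0 w = f [set w]) ->
    (forall j (w : 'I_n), nmem t 3 j w = if w == v then
       part f k (saturated s) j v : nat else nmem s2 3 j w) ->
    I m.+1 t.
  move=> Nt ft t3; split=> [||//|j|j w]; rewrite ?t3 ?Nt // s23 ltnS.
  case: eqVneq => [-> /=|]; first by rewrite leqnn.
  by rewrite -val_eqE /= [(w <= m)%N]leq_eqVlt => /negbTE ->.
have wm (w : 'I_n) : (w == m :> nat) = (w == v) by rewrite -val_eqE.
have s20 j : nmem s2 3 j v = 0%N by rewrite s23 ltnn.
have sat_v : (v \in saturated s) = (nmem s 4 0 v != 0%N) by rewrite inE.
rewrite !run_PIf ![beval _ _]/= c2 s2k s2v s24.
case: ifPn => [rv|]; last rewrite -ltnNge => rv.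
  apply: step => [a b c||j w].
  - rewrite !inE !negb_or /= /upd => /andP[a3 a7].
    by rewrite (negbTE a3) (negbTE a7).
  - by [].
  - rewrite /= /upd /= c2 s2v /part rv (inj_eq val_inj).
    by case: (eqVneq w v) => [->|]; rewrite ?andbT ?andbF ?s20 //; case: eqP.
case: ifPn => [pv|npv].
  apply: step => [a b c||j w].
  - rewrite !inE !negb_or /= /upd => /andP[a3 a7].
    by rewrite (negbTE a3) (negbTE a7).
  - by [].
  - rewrite /= /upd /= s2k s2v /part leqNgt rv /= wm sat_v.
    have -> : (rk v < k)%N || (nmem s 4 0 v != 0%N) by move: pv; lia.
    by case: (eqVneq w v) => [->|]; rewrite ?andbT ?andbF ?s20 //; case: eqP.
apply: step => [a b c||j w].
- by rewrite !inE !negb_or /= /upd => /andP[a3 a7]; rewrite (negbTE a7).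
- by [].
- rewrite [LHS]/= /part leqNgt rv /= sat_v.
  have -> : (rk v < k)%N || (nmem s 4 0 v != 0%N) = false.
    by apply/negbTE; move: npv; lia.
  by case: eqVneq => [->|//]; rewrite andbF; exact: s20.
Qed.

End Verification.

(** * Running time, feasibility and ratio of the compiled program *)

Theorem corollary1 (R : realType) :
  exists (P : cmd) (C d : nat),
    forall (n k : nat) (e : rel 'I_n) (f : {set 'I_n} -> R),
      symmetric e -> irreflexive e ->
      (1 <= k)%N -> (k <= n)%N ->
      nonnegative f -> monotone f -> submodular f ->
      exists (s : state R) (t : nat),
        [/\ exec f P (input R k e) s t,
            (t <= C * n ^ d)%N,
            feasible e (output n k s)
          & exists T : 'I_k -> {set 'I_n},
              optimal e f T /\
              cost f (output n k s) <= 3%:R * cost f T].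
Proof.
have [C [d timeP]] := time_poly partition_cover.
exists (compile partition_cover), C, d.
move=> n k e f e_sym _ k_gt0 le_kn f_ge0 f_mono f_sub.
pose s0 := input R k e; pose s := run f partition_cover s0.
have s0n : nmem s0 0 0 0 = n by [].
have [||t et lt] := @exec_run _ _ f partition_cover s0 n _ _ s0n => //.
exists s, t; have lt' := leq_trans lt (timeP n (leq_trans k_gt0 le_kn)).
pose s1 := run f singletons s0.
have sf1 := run_singletons f s0n (fun _ _ => erefl).
have [N1 R1] := (@nmem_run _ _ f singletons s0, @rmem_run _ _ f singletons s0).
rewrite -/s1 in sf1 N1 R1.
(* Layer 0 gets weight 1 while array 6 is still zero: the point mass at the empty set. *)
pose s2 := setr s1 0 0 0 1.
have s2e (u v : 'I_n) : nmem s2 2 u v = e u v.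
  rewrite [LHS]N1 //=; congr nat_of_bool; apply/existsP/idP => [[x]|euv].
    by case/existsP => y /and3P[/eqP/val_inj -> /eqP/val_inj ->].
  by exists u; apply/existsP; exists v; rewrite !eqxx.
have cov2 : covering f e (weight s2) (layer n s2) (saturated n s2).
  have -> : saturated n s2 = set0.
    by apply/setP => v; rewrite !inE [nmem _ _ _ _]N1.
  apply: covering_init => i.
    rewrite /weight /= /upd /=; case: (i == 0%N) => //.
    by rewrite R1.
  by apply/setP => v; rewrite !inE [nmem _ _ _ _]N1.
have s2n : nmem s2 0 0 0 = n by rewrite [LHS]N1.
have [] := run_scan f_mono f_sub e_sym s2n s2e cov2.
have [N3 R3] := (@nmem_run _ _ f scan s2, @rmem_run _ _ f scan s2).
have sE : s = run f place (run f scan s2) by [].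
move: (run f scan s2) N3 R3 sE => s3 N3 R3 sE cov3 cover3.
have s3n : nmem s3 0 0 0 = n by rewrite N3.
have s3k : nmem s3 1 0 0 = k by rewrite N3 // [LHS]N1.
have s30 i j : nmem s3 3 i j = 0%N by rewrite N3 // [LHS]N1.
have s3f (w : 'I_n) : rmem s3 1 0 w = f [set w] by rewrite R3 // [LHS]sf1.
have outE i : output n k s i = parts f (saturated n s3) i.
  by rewrite /output sE (run_place k_gt0 s3n s3k s30 s3f).
have {}outE : output n k s = parts f (saturated n s3) by apply: funext.
have feas := parts_feasible f k_gt0 le_kn cover3.
rewrite outE; split=> //.
(* An optimum exists because finite functions form a finite type and the output itself is
   feasible. *)
pose F := {ffun 'I_k -> {set 'I_n}}.
have ffunE' (S : 'I_k -> {set 'I_n}) : finfun S = S :> ('I_k -> _).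
  by apply: funext => i; rewrite ffunE.
have feas0 : `[< feasible e (finfun (parts f (saturated n s3)) : F) >].
  by apply/asboolP; rewrite ffunE'.
case: (@arg_minP _ _ F _ (fun T : F => `[< feasible e T >])
  (fun T : F => cost f T) feas0) => T /asboolP feasT minT.
exists T; split; first split=> // S feasS.
  by rewrite -[S]ffunE'; apply: minT; apply/asboolP; rewrite ffunE'.
(* The cover contributes 2 and the k vertices of least rank contribute 1. *)
have -> : 3%:R = 2 + 1 :> R by rewrite -natr1.
apply: cost_parts_le feasT => // O.
exact: covering_le cov3.
Qed.
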